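(* The Quantum Yang–Mills theory gauge fixing Lagrange density and its accompanying ghost Lagrange density $$\begin{aligned}\mathcal L_{\mathrm{QYM\text{-}GF}}+\mathcal L_{\mathrm{QYM\text{-}Ghost}}=&-\frac1{2\mathrm g^2\xi}\delta_{ab}\,lL^a\,lL^b\,dV_\eta-\frac1\xi\eta^{\mu\nu}\overline c_a(\partial_\mu\partial_\nu c^a)\,dV_\eta\\&-\mathrm g\,\eta^{\mu\nu}f^a{}_{bc}\overline c_a\big(\partial_\mu(c^bA^c_\nu)\big)dV_\eta\end{aligned}$$ for the linearized Lorenz gauge fixing functional $lL^a:=\mathrm g\,\eta^{\mu\nu}(\partial_\mu A^a_\nu)$ can be obtained from the gauge fixing fermion $\digamma\in\mathcal C_{\mathbf Q}^{\{0\},(0,-1)}$, $$\digamma:=\overline c_a\Big(\frac1{\mathrm g}lL^a+\frac12b^a\Big)dV_\eta,$$ via $Q\digamma$, where $Q$ is the gauge BRST operator.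
   Context: Setting. $\eta$ is the Minkowski background metric on spacetime $M$, $dV_\eta=dt\wedge dx\wedge dy\wedge dz$. $\mathfrak g$ is the Lie algebra of the gauge group with structure constants $f^a{}_{bc}$, $\mathrm g$ the gauge coupling constant, $\xi$ the gauge fixing parameter. Relevant fields with bidegree (graviton-ghost degree, gauge ghost degree): gauge boson $A^a_\mu$ and auxiliary Lautrup–Nakanishi field $b_a$ of degree $(0,0)$; gauge ghost $c^a$ of degree $(0,1)$; gauge antighost $\overline c_a$ of degree $(0,-1)$; parity is total degree mod 2. Gauge indices are raised and lowered with $\delta_{ab}$. $\mathcal C_{\mathbf Q}^{\{w\},(i,j)}$ is the part of bidegree $(i,j)$ and tensor density weight $w$ of the superalgebra of graded-symmetric polynomial functionals of fields and derivatives. The gauge BRST operator $Q$ is the odd superderivation of bidegree $(0,1)$, commuting with $\partial_\mu$, with $QA^a_\mu=\frac1\xi\partial_\mu c^a+\mathrm gf^a{}_{bc}c^bA^c_\mu$; $Qc^a=\frac{\mathrm g}2f^a{}_{bc}c^bc^c$; $Q\overline c_a=\frac1\xi b_a$; $Qb_a=0$; $Q\delta_{ab}=0$; $Q\eta_{\mu\nu}=0$. ''Obtained via $Q\digamma$'' means: equal to $Q\digamma$ after eliminating the auxiliary field $b$ by inserting its equation of motion, i.e. the Euler–Lagrange equation of $Q\digamma$ with respect to $b_a$. *)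

(* Defs.v *)
From HB Require Import structures.
From mathcomp Require Import all_boot all_order all_algebra finmap.
From mathcomp Require Import boolp classical_sets cardinality fsbigop reals.
From mathcomp Require Import monalg ring.
Set Implicit Arguments.
Unset Strict Implicit.
Unset Printing Implicit Defensive.
Import GRing.Theory Num.Theory.
Local Open Scope ring_scope.
Local Open Scope quotient_scope.

Section TwoSidedQuotient.
Variables (R : nzRingType) (T : lalgType R) (I : {pred T}).

Record proper_ideal2 : Prop := ProperIdeal2 {
  ideal2_zmod : zmod_closed I;
  ideal2_mul : forall l x r, x \in I -> l * x * r \in I;
  ideal2_scaleC : forall a (x y : T), x * (a *: y) - a *: (x * y) \in I;
  ideal2_proper : 1 \notin I
}.

Variable hI : proper_ideal2.

HB.instance Definition _ := GRing.isZmodClosed.Build T I (ideal2_zmod hI).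

Definition quot2 := let _ := hI in Quotient.quot (I : zmodClosed T).

HB.instance Definition _ := GRing.Zmodule.on quot2.
HB.instance Definition _ := EqQuotient.on quot2.

Local Notation C := quot2.
Definition qpi : T -> C := \pi_C.

Lemma qpiK x : qpi (repr x) = x.
Proof. exact: reprK. Qed.

Lemma qpiP x y : qpi x = qpi y <-> x - y \in I.
Proof.
by split=> [/eqP|h]; [|apply/eqP]; rewrite -?Quotient.idealrBE // => ->.
Qed.

Lemma qpi_zmod : zmod_morphism qpi.
Proof. by move=> x y; rewrite /qpi !piE. Qed.
HB.instance Definition _ := GRing.isZmodMorphism.Build T C qpi qpi_zmod.

Fact quot2_key : unit. Proof. by []. Qed.
Let one : C := locked_with quot2_key (qpi 1).
Let mul : C -> C -> C :=
  locked_with quot2_key (fun x y => qpi (repr x * repr y)).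
Let scale : R -> C -> C := locked_with quot2_key (fun a x => qpi (a *: repr x)).

Let reprI z : z - repr (qpi z) \in I.
Proof. by apply/qpiP; rewrite qpiK. Qed.

Let addI x y : x \in I -> y \in I -> x + y \in I.
Proof.
have [I0 IB] := ideal2_zmod hI => Ix Iy.
by rewrite -[y]opprK IB // -[- y]sub0r IB.
Qed.

Let piM x y : qpi (x * y) = mul (qpi x) (qpi y).
Proof.
rewrite /mul unlock; apply/qpiP.
have -> : x * y - repr (qpi x) * repr (qpi y) =
  1 * (x - repr (qpi x)) * y + repr (qpi x) * (y - repr (qpi y)) * 1.
  by rewrite mul1r mulr1 mulrBl mulrBr addrA subrK.
by apply: addI; apply: ideal2_mul.
Qed.

Let piZ a x : qpi (a *: x) = scale a (qpi x).
Proof.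
rewrite /scale unlock; apply/qpiP; rewrite -scalerBr.
rewrite -[_ - _]mul1r scalerAl -[_ * _]mulr1.
exact: ideal2_mul.
Qed.

Let piD x y : qpi (x + y) = qpi x + qpi y. Proof. exact: raddfD. Qed.
Let pi1 : qpi 1 = one. Proof. by rewrite /one unlock. Qed.

Let mulA : associative mul.
Proof.
by move=> x y z; rewrite -(qpiK x) -(qpiK y) -(qpiK z) -!piM mulrA.
Qed.
Let mul1 : left_id one mul.
Proof. by move=> x; rewrite -pi1 -(qpiK x) -piM mul1r. Qed.
Let mul1' : right_id one mul.
Proof. by move=> x; rewrite -pi1 -(qpiK x) -piM mulr1. Qed.
Let mulDl : left_distributive mul +%R.
Proof.
move=> x y z; rewrite -(qpiK x) -(qpiK y) -(qpiK z).
by rewrite -!piM -!piD -piM mulrDl.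
Qed.
Let mulDr : right_distributive mul +%R.
Proof.
move=> x y z; rewrite -(qpiK x) -(qpiK y) -(qpiK z).
by rewrite -!piM -!piD -piM mulrDr.
Qed.
Let one_neq0 : one != 0.
Proof.
apply/eqP; rewrite -pi1 -(raddf0 qpi) => /qpiP; rewrite subr0.
by apply/negP/ideal2_proper.
Qed.

HB.instance Definition _ := GRing.Zmodule_isNzRing.Build C
  mulA mul1 mul1' mulDl mulDr one_neq0.

Lemma qpi_monoid : monoid_morphism qpi.
Proof. by split=> [|x y]; [exact: pi1 | exact: piM]. Qed.
HB.instance Definition _ := GRing.isMonoidMorphism.Build T C qpi qpi_monoid.

Let scaleA a b x : scale a (scale b x) = scale (a * b) x.
Proof. by rewrite -(qpiK x) -!piZ scalerA. Qed.
Let scale1 : left_id 1 scale.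
Proof. by move=> x; rewrite -(qpiK x) -piZ scale1r. Qed.
Let scaleDr : right_distributive scale +%R.
Proof.
by move=> a x y; rewrite -(qpiK x) -(qpiK y) -piD -!piZ scalerDr piD.
Qed.
Let scaleDl x : {morph scale^~ x : a b / a + b}.
Proof. by move=> a b; rewrite -(qpiK x) -!piZ scalerDl piD. Qed.

HB.instance Definition _ := GRing.Zmodule_isLmodule.Build R C
  scaleA scale1 scaleDr scaleDl.

Lemma qpi_scalable : scalable qpi.
Proof. exact: piZ. Qed.
HB.instance Definition _ := GRing.isScalable.Build R T C *:%R qpi qpi_scalable.

Let scaleAl a (x y : C) : a *: (x * y) = (a *: x) * y.
Proof.
by rewrite -(qpiK x) -(qpiK y) -rmorphM -!linearZ -rmorphM scalerAl.
Qed.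
HB.instance Definition _ := GRing.Lmodule_isLalgebra.Build R C scaleAl.

Let scaleAr a (x y : C) : a *: (x * y) = x * (a *: y).
Proof.
rewrite -(qpiK x) -(qpiK y) -rmorphM -!linearZ -rmorphM /=.
by apply/esym/qpiP/ideal2_scaleC.
Qed.
HB.instance Definition _ := GRing.Lalgebra_isAlgebra.Build R C scaleAr.

End TwoSidedQuotient.

Section IdealGenerated.
Variables (T : nzRingType) (K : Type) (g : K -> T).

(* The two-sided ideal generated by the family g. *)
Inductive in_ideal_gen : T -> Prop :=
| in_ideal_gen0 : in_ideal_gen 0
| in_ideal_genD x l k r :
    in_ideal_gen x -> in_ideal_gen (x + l * g k * r).

Definition ideal_gen : {pred T} := fun x => `[< in_ideal_gen x >].

Lemma ideal_genP x : reflect (in_ideal_gen x) (x \in ideal_gen).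
Proof. exact: asboolP. Qed.

Lemma ideal_gen_base k : g k \in ideal_gen.
Proof.
apply/ideal_genP.
by have := in_ideal_genD 1 k 1 in_ideal_gen0; rewrite add0r mul1r mulr1.
Qed.

Lemma ideal_gen_mul l x r : x \in ideal_gen -> l * x * r \in ideal_gen.
Proof.
move=> /ideal_genP h; apply/ideal_genP.
elim: h => [|z l' u r' _ IH]; first by rewrite mulr0 mul0r; constructor.
have -> : l * (z + l' * g u * r') * r =
          l * z * r + (l * l') * g u * (r' * r).
  by rewrite mulrDr mulrDl !mulrA.
by constructor.
Qed.

Lemma ideal_gen_zmod : zmod_closed ideal_gen.
Proof.
split=> [|x y /ideal_genP hx hy]; first by apply/ideal_genP; constructor.
have /ideal_genP := ideal_gen_mul (-1) 1 hy.
rewrite mulr1 mulN1r => {}hy; apply/ideal_genP.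
elim: hy => [|z l u r _ IH]; first by rewrite addr0.
by rewrite addrA; constructor.
Qed.

Lemma ideal_gen_additive (S : zmodType) (e : {additive T -> S}) :
  (forall l k r, e (l * g k * r) = 0) -> forall x, x \in ideal_gen -> e x = 0.
Proof.
move=> e0 x /ideal_genP; elim=> [|y l k r _ IH]; first exact: raddf0.
by rewrite raddfD IH add0r; apply: e0.
Qed.

Lemma mul_sum3 (I1 I2 : Type) (s1 : seq I1) (s2 : seq I2)
    (F : I1 -> T) (G : I2 -> T) a :
  (\sum_(i <- s1) F i) * a * (\sum_(j <- s2) G j)
  = \sum_(i <- s1) \sum_(j <- s2) F i * a * G j.
Proof. by rewrite 2!mulr_suml; apply: eq_bigr => i _; rewrite mulr_sumr. Qed.

End IdealGenerated.

Lemma sign_swap (R : nzRingType) (V : lmodType R) (q a b : bool) (x y : V) :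
  (-1) ^+ ((q (+) a) && b) *: y + (-1) ^+ (q && a) *: x =
  (-1) ^+ (a && b) *:
    ((-1) ^+ ((q (+) b) && a) *: x + (-1) ^+ (q && b) *: y).
Proof.
rewrite scalerDr !scalerA -!signr_addb addrC.
by congr (_ ^+ _ *: _ + _ ^+ _ *: _); case: q a b => [] [] [].
Qed.

Section SuperAlgebra.
Variables (R : numFieldType) (J : choiceType) (p : J -> bool).

Local Notation T := {malg R[{fmonom J}]}.

Definition tgen (v : J) : T := << fmu v >>.

Definition supercomm (u v : J) : T :=
  tgen u * tgen v - (-1) ^+ (p u && p v) *: (tgen v * tgen u).

Definition sideal : {pred T} := ideal_gen (fun uv => supercomm uv.1 uv.2).

Lemma malgZU (c a : R) (m : {fmonom J}) : c *: << a *g m >> = << c * a *g m >> :> T.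
Proof.
apply/malgP => k; rewrite (mcoeffZ c _ k) (mcoeffU m a k).
by rewrite (mcoeffU m (c * a) k) (mulrnAr c a).
Qed.

Lemma malgMU (c1 c2 : R) (m1 m2 : {fmonom J}) :
  << c1 *g m1 >> * << c2 *g m2 >> = << c1 * c2 *g mmul m1 m2 >> :> T.
Proof. by rewrite malgM_def fgmulUU. Qed.

Lemma tscaleAr (a : R) (x y : T) : x * (a *: y) = a *: (x * y).
Proof.
rewrite (malgMEw (fsubset_refl _) (msuppZ_le a y)) malgME scaler_sumr.
apply: eq_bigr => i _; rewrite scaler_sumr; apply: eq_bigr => j _.
by rewrite malgZU (mcoeffZ a y j) mulrCA.
Qed.

(* Killing every generator is a ring morphism that vanishes on the ideal. *)
Lemma sideal_const x : x \in sideal -> x@_(@mone {fmonom J}) = 0.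
Proof.
have cM (a b : T) : (a * b)@_(@mone {fmonom J}) =
    a@_(@mone {fmonom J}) * b@_(@mone {fmonom J}).
  exact: (mcoeff1g_is_multiplicative {fmonom J} R).1.
have g0 v (a : T) : (tgen v * a)@_(@mone {fmonom J}) = 0.
  by rewrite (cM (tgen v) a) /tgen mcoeffU1 fm1_eq1 mul0r.
apply: (@ideal_gen_additive _ _ _ _
  (GRing.Additive.clone _ _ (mcoeff (@mone {fmonom J})) _)) => l [u v] r /=.
rewrite (cM (l * _) r) (cM l) /supercomm (mcoeffB _ (tgen u * tgen v)) g0.
rewrite (mcoeffZ _ (tgen v * tgen u)) g0.
by rewrite mulr0 subrr mulr0 mul0r.
Qed.

Lemma sideal_proper : proper_ideal2 sideal.
Proof.
split.
- exact: ideal_gen_zmod.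
- exact: ideal_gen_mul.
- by move=> a x y; rewrite tscaleAr subrr; apply: (ideal_gen_zmod _).1.
- by apply/negP => /sideal_const/eqP; rewrite mcoeff1 eqxx oner_eq0.
Qed.

Record superalg_data := SuperAlgData {
  superalg_of : algType R;
  spi_of : {lrmorphism T -> superalg_of};
  srepr_of : superalg_of -> T
}.

Fact superalg_key : unit. Proof. by []. Qed.

(* Locked for performance only. *)
Definition superalg_def : superalg_data :=
  locked_with superalg_key
    (@SuperAlgData (quot2 sideal_proper) (qpi sideal_proper) repr).

(* The free supercommutative R-algebra on J, p giving the parities. In
   characteristic 0 the relations include v * v = 0 for odd v. *)
Definition superalg : algType R := superalg_of superalg_def.

Local Notation C := superalg.
Definition spi : {lrmorphism T -> C} := spi_of superalg_def.
Definition srepr : C -> T := @srepr_of superalg_def.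

Lemma srepr_spi (x : C) : spi (srepr x) = x.
Proof.
by move: x; rewrite /spi /srepr /superalg /superalg_def unlock; exact: qpiK.
Qed.

Lemma spiP x y : spi x = spi y <-> x - y \in sideal.
Proof.
by rewrite /spi /superalg /superalg_def unlock; exact: qpiP.
Qed.

Definition sgen (v : J) : C := spi (tgen v).

Lemma sgenC u v :
  sgen u * sgen v = (-1) ^+ (p u && p v) *: (sgen v * sgen u).
Proof.
rewrite /sgen -!(rmorphM spi) -(linearZ_LR spi); apply/spiP.
exact: (ideal_gen_base _ (u, v)).
Qed.

(* The product, in order, of the generators listed in a word. *)
Definition sword (w : seq J) : C := \prod_(v <- w) sgen v.

Lemma sword0 : sword [::] = 1. Proof. exact: big_nil. Qed.
Lemma sword_cons v w : sword (v :: w) = sgen v * sword w.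
Proof. exact: big_cons. Qed.
Lemma sword_cat w1 w2 : sword (w1 ++ w2) = sword w1 * sword w2.
Proof. exact: big_cat. Qed.

Lemma spi_word (m : {fmonom J}) : spi << m >> = sword m.
Proof.
case: m; elim=> [|v w IH].
  rewrite sword0 -(rmorph1 spi); congr (spi << _ >>).
  by apply: val_inj; rewrite /= fm1.
rewrite sword_cons -IH -(rmorphM spi); congr (spi _).
rewrite /tgen malgMU mulr1; congr << _ >>.
by apply: val_inj; rewrite /= fmM fmuE.
Qed.

(* [spanned P x]: x is a linear combination of the words satisfying P. *)
Definition spanned (P : seq J -> Prop) (x : C) : Prop :=
  exists2 y : T, spi y = x & forall m, m \in msupp y -> P m.

(* Linear extension from words to the free algebra. *)
Definition wlin (S : lmodType R) (h : seq J -> S) (x : T) : S :=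
  \sum_(m <- msupp x) x@_m *: h m.

(* The algebra morphism sending each generator v to h v. It is independent of
   the representative when the h v supercommute like the generators. *)
Definition slift (S : algType R) (h : J -> S) (x : C) : S :=
  wlin (fun w => \prod_(v <- w) h v) (srepr x).

Fixpoint dword (q : bool) (phi : J -> C) (w : seq J) : C :=
  if w is v :: w' then
    phi v * sword w' + (-1) ^+ (q && p v) *: (sgen v * dword q phi w')
  else 0.

(* The superderivation of parity q (acting from the left) sending each
   generator v to phi v. It is independent of the representative when phi v
   has parity q + p v. *)
Definition sderiv (q : bool) (phi : J -> C) (x : C) : C :=
  wlin (dword q phi) (srepr x).

Lemma wlinEw (S : lmodType R) (h : seq J -> S) (d : {fset {fmonom J}}) x :
  (msupp x `<=` d)%fset -> wlin h x = \sum_(m <- d) x@_m *: h m.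
Proof.
move=> le; rewrite /wlin (big_fset_incl _ le) // => m _ /mcoeff_outdom ->.
by rewrite scale0r.
Qed.

Lemma wlin_linear (S : lmodType R) (h : seq J -> S) : linear (wlin h).
Proof.
move=> a x y.
pose d := (msupp x `|` msupp y `|` msupp (a *: x + y))%fset.
have [dx dy dxy] : [/\ (msupp x `<=` d)%fset, (msupp y `<=` d)%fset
    & (msupp (a *: x + y) `<=` d)%fset].
  by split; apply/fsubsetP => m; rewrite !inE => ->; rewrite ?orbT.
rewrite (wlinEw h dx) (wlinEw h dy) (wlinEw h dxy).
rewrite scaler_sumr -big_split; apply: eq_bigr => m _ /=.
by rewrite mcoeffD mcoeffZ scalerDl scalerA.
Qed.
HB.instance Definition _ (S : lmodType R) (h : seq J -> S) :=
  GRing.isLinear.Build R T S *:%R (@wlin S h)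
  (@wlin_linear S h).

Lemma wlinU (S : lmodType R) (h : seq J -> S) (m : {fmonom J}) :
  wlin h << m >> = h m.
Proof.
rewrite (@wlinEw _ _ [fset m]%fset) ?msuppU_le //.
by rewrite big_seq_fset1 mcoeffUU scale1r.
Qed.

Lemma spiE x : spi x = wlin sword x.
Proof.
rewrite {1}[x]monalgE raddf_sum; apply: eq_bigr => m _.
by rewrite -spi_word -(linearZ_LR spi) malgZU mulr1.
Qed.

(* A linear extension descends to the superalgebra as soon as it respects the
   exchange of two neighbouring generators. *)
Lemma wlin_repr (S : lmodType R) (h : seq J -> S) :
    (forall w1 u v w2, h (w1 ++ [:: u, v & w2]) =
       (-1) ^+ (p u && p v) *: h (w1 ++ [:: v, u & w2])) ->
  forall x, wlin h (srepr (spi x)) = wlin h x.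
Proof.
move=> hh x.
suff h0 y : y \in sideal -> wlin h y = 0.
  apply/esym/eqP; rewrite -subr_eq0 -raddfB; apply/eqP/h0/spiP.
  by rewrite srepr_spi.
apply: ideal_gen_additive => l [u v] r /=.
have sc (k : {fmonom J}) c : << c *g k >> = c *: (<< k >> : T).
  by rewrite malgZU mulr1.
have mw w1 w2 :
    << FMonom w1 >> * << FMonom w2 >> = << FMonom (w1 ++ w2) >> :> T.
  by rewrite malgMU mulr1; congr << _ >>; apply: val_inj; rewrite /= fmM.
have hr w1 w2 : wlin h (<< FMonom w1 >> * supercomm u v * << FMonom w2 >>) = 0.
  rewrite /supercomm /tgen !fmuE !mw mulrBr mulrBl tscaleAr -scalerAl !mw.
  by rewrite raddfB /= linearZ /= !wlinU /= -!catA /= hh subrr.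
rewrite [l]monalgE [r]monalgE mul_sum3 raddf_sum big1 // => m _.
rewrite raddf_sum big1 // => m' _.
rewrite (sc m) (sc m') tscaleAr -(scalerAl (l@_m)) -(scalerAl (l@_m)).
rewrite /= linearZ /= linearZ /=.
by case: m m' => [w1] [w2]; rewrite hr !scaler0.
Qed.

Lemma wlin_spi (S : lmodType R) (h : seq J -> S) :
    (forall w1 u v w2, h (w1 ++ [:: u, v & w2]) =
       (-1) ^+ (p u && p v) *: h (w1 ++ [:: v, u & w2])) ->
  forall w, wlin h (srepr (sword w)) = h w.
Proof. by move=> hh w; rewrite -(spi_word (FMonom w)) wlin_repr // wlinU. Qed.

Lemma superalg_ind (P : C -> Prop) :
    (forall w, P (sword w)) -> (forall a x y, P x -> P y -> P (a *: x + y)) ->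
  forall x, P x.
Proof.
move=> Pw PD x; rewrite -(srepr_spi x) spiE /wlin.
have P0 : P 0.
  by have := PD (-1) _ _ (Pw [::]) (Pw [::]); rewrite scaleN1r addNr.
elim: (enum_fset _) => [|m s IH]; first by rewrite big_nil.
by rewrite big_cons; apply: PD.
Qed.

Section Lift.
Variables (S : algType R) (h : J -> S).
Hypothesis hC : forall u v, h u * h v = (-1) ^+ (p u && p v) *: (h v * h u).

Let hswap w1 u v w2 : \prod_(x <- w1 ++ [:: u, v & w2]) h x =
  (-1) ^+ (p u && p v) *: \prod_(x <- w1 ++ [:: v, u & w2]) h x.
Proof.
by rewrite !big_cat !big_cons /= !mulrA -[_ * h u * h v]mulrA hC
  -scalerAr -!scalerAl !mulrA.
Qed.

Lemma slift_linear : linear (slift h).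
Proof.
move=> a x y; rewrite /slift -[x]srepr_spi -[y]srepr_spi -linearZ -raddfD.
by rewrite !(wlin_repr hswap) linearP.
Qed.

Lemma slift_sword w : slift h (sword w) = \prod_(v <- w) h v.
Proof. exact: (wlin_spi hswap). Qed.

Lemma slift_sgen v : slift h (sgen v) = h v.
Proof.
by rewrite -[sgen v]mulr1 -sword0 -sword_cons slift_sword big_seq1.
Qed.

Lemma slift_monoid : monoid_morphism (slift h).
Proof.
have lin a x y : slift h (a *: x + y) = a *: slift h x + slift h y.
  exact: slift_linear.
split=> [|x y]; first by rewrite -sword0 slift_sword big_nil.
elim/superalg_ind: x => [w|a x x' IH IH']; last first.
  by rewrite mulrDl -scalerAl !lin IH IH' mulrDl scalerAl.
elim/superalg_ind: y => [w'|a y y' IH IH']; last first.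
  by rewrite mulrDr -scalerAr !lin IH IH' mulrDr scalerAr.
by rewrite -sword_cat !slift_sword big_cat.
Qed.
End Lift.

Definition wpar (w : seq J) : bool := odd (count p w).

Lemma wpar_cat w1 w2 : wpar (w1 ++ w2) = wpar w1 (+) wpar w2.
Proof. by rewrite /wpar count_cat oddD. Qed.
Lemma wpar_cons v w : wpar (v :: w) = p v (+) wpar w.
Proof. by rewrite /wpar /= oddD oddb. Qed.

Section Deriv.
Variables (q : bool) (phi : J -> C).
Hypothesis phiC : forall u v,
  phi u * sgen v = (-1) ^+ ((q (+) p u) && p v) *: (sgen v * phi u).

Lemma dword_cat w1 w2 : dword q phi (w1 ++ w2) =
  dword q phi w1 * sword w2
  + (-1) ^+ (q && wpar w1) *: (sword w1 * dword q phi w2).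
Proof.
elim: w1 => [|v w1 IH] /=.
  by rewrite mul0r add0r andbF scale1r sword0 mul1r.
rewrite IH sword_cat sword_cons wpar_cons mulrDl -addrA; congr (_ + _).
  by rewrite mulrA.
rewrite mulrDr scalerDr -scalerAl !mulrA; congr (_ + _).
by rewrite -scalerAr scalerA -signr_addb -andb_addr mulrA.
Qed.

Let dswap w1 u v w2 : dword q phi (w1 ++ [:: u, v & w2]) =
  (-1) ^+ (p u && p v) *: dword q phi (w1 ++ [:: v, u & w2]).
Proof.
have cc x y (w : seq J) : [:: x, y & w] = [:: x; y] ++ w by [].
have s2 x y : sword [:: x; y] = sgen x * sgen y.
  by rewrite !sword_cons sword0 mulr1.
have w2E : wpar [:: u; v] = wpar [:: v; u] by rewrite /wpar /= addnCA.
have d2 : dword q phi [:: u; v]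
    = (-1) ^+ (p u && p v) *: dword q phi [:: v; u].
  have dw2 x y : dword q phi [:: x; y] =
      phi x * sgen y + (-1) ^+ (q && p x) *: (sgen x * phi y).
    by rewrite /= sword_cons sword0 !mulr1 mulr0 scaler0 addr0.
  by rewrite !dw2 (phiC u v) (phiC v u) sign_swap.
rewrite (cc u v w2) (cc v u w2) !dword_cat !sword_cat !s2 w2E d2.
rewrite (sgenC u v) !(scalerDr, mulrDr, =^~ scalerAl, =^~ scalerAr) !scalerA.
by congr (_ + (_ + _)); congr (_ *: _);
  [exact: mulrC | rewrite mulrA mulrC mulrA].
Qed.

Lemma sderiv_linear : linear (sderiv q phi).
Proof.
move=> a x y; rewrite /sderiv -[x]srepr_spi -[y]srepr_spi -linearZ -raddfD.
by rewrite !(wlin_repr dswap) linearP.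
Qed.

Lemma sderiv_sword w : sderiv q phi (sword w) = dword q phi w.
Proof. exact: (wlin_spi dswap). Qed.

Lemma sderiv_sgen v : sderiv q phi (sgen v) = phi v.
Proof.
rewrite -[sgen v]mulr1 -sword0 -sword_cons sderiv_sword /=.
by rewrite sword0 mulr1 mulr0 scaler0 addr0.
Qed.

Lemma sderiv_leibniz w y : sderiv q phi (sword w * y) =
  sderiv q phi (sword w) * y
  + (-1) ^+ (q && wpar w) *: (sword w * sderiv q phi y).
Proof.
elim/superalg_ind: y => [w'|a x y IHx IHy].
  by rewrite -sword_cat !sderiv_sword dword_cat.
have lin b z t : sderiv q phi (b *: z + t) = b *: sderiv q phi z + sderiv q phi t.
  exact: sderiv_linear.
rewrite mulrDr -scalerAr !lin IHx IHy !mulrDr !scalerDr addrACA.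
congr (_ + _ + _); first by rewrite scalerAr.
by rewrite -!scalerAr !scalerA mulrC.
Qed.

End Deriv.

Lemma spannedP (P : seq J -> Prop) (Q : C -> Prop) :
    Q 0 -> (forall w, P w -> Q (sword w)) ->
    (forall a x y, Q x -> Q y -> Q (a *: x + y)) ->
  forall x, spanned P x -> Q x.
Proof.
move=> Q0 Qw QD _ [y <- Py]; rewrite spiE /wlin.
have : {in enum_fset (msupp y), forall m : {fmonom J}, P m} by [].
elim: (enum_fset _) => [|m s IH] Ps.
  by rewrite big_nil.
rewrite big_cons; apply: QD; first by apply/Qw/Ps; rewrite inE eqxx.
by apply: IH => m' sm'; apply: Ps; rewrite inE sm' orbT.
Qed.

Lemma spanned_word (P : seq J -> Prop) w : P w -> spanned P (sword w).
Proof.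
move=> Pw; exists << FMonom w >>; first by rewrite spi_word.
by move=> m /(fsubsetP msuppU_le); rewrite in_fset1 => /eqP ->.
Qed.

Lemma spanned_gen (P : seq J -> Prop) v : P [:: v] -> spanned P (sgen v).
Proof.
by move=> /spanned_word; rewrite sword_cons sword0 mulr1.
Qed.

Lemma spanned0 P : spanned P 0.
Proof. by exists 0; [exact: raddf0 | move=> m; rewrite msupp0]. Qed.

Lemma spanned_lin P a x y : spanned P x -> spanned P y -> spanned P (a *: x + y).
Proof.
move=> [x' <- Px] [y' <- Py]; exists (a *: x' + y'); first exact: linearP.
move=> m /(fsubsetP (msuppD_le _ _)); rewrite in_fsetU => /orP[|/Py //].
by move=> /(fsubsetP (msuppZ_le _ _))/Px.
Qed.

Lemma spannedM (P1 P2 P : seq J -> Prop) x y :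
    (forall w1 w2, P1 w1 -> P2 w2 -> P (w1 ++ w2)) ->
  spanned P1 x -> spanned P2 y -> spanned P (x * y).
Proof.
move=> PP Px Py.
apply: (spannedP (Q := fun x => spanned P (x * y)) _ _ _ Px) => [|w1 Pw1|a x1 x2 IH1 IH2].
- by rewrite mul0r; apply: spanned0.
- apply: (spannedP (Q := fun y => spanned P (_ * y)) _ _ _ Py) => [|w2 Pw2|a y1 y2 IH1 IH2].
  + by rewrite mulr0; apply: spanned0.
  + by rewrite -sword_cat; apply/spanned_word/PP.
  + by rewrite mulrDr -scalerAr; apply: spanned_lin.
- by rewrite mulrDl -scalerAl; apply: spanned_lin.
Qed.

Lemma spanned_sub (P1 P2 : seq J -> Prop) x :
  (forall w, P1 w -> P2 w) -> spanned P1 x -> spanned P2 x.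
Proof. by move=> PP [y <- Py]; exists y => // m /Py/PP. Qed.

Lemma spanned_supercomm a b x y :
  spanned (fun w => wpar w = a) x -> spanned (fun w => wpar w = b) y ->
  x * y = (-1) ^+ (a && b) *: (y * x).
Proof.
move=> Px Py.
pose Q x y := x * y = (-1) ^+ (a && b) *: (y * x) :> C.
apply: (spannedP (Q := Q^~ y) _ _ _ Px) => [|w1 ew1|c x1 x2]; rewrite /Q.
- by rewrite mul0r mulr0 scaler0.
- apply: (spannedP (Q := Q (sword w1)) _ _ _ Py) => [|w2 ew2|c y1 y2]; rewrite /Q.
  + by rewrite mul0r mulr0 scaler0.
  + rewrite -ew1 -ew2; elim: {ew1 Py} w1 => [|u w1 IH]; first by rewrite sword0 mul1r mulr1 scale1r.
    rewrite sword_cons -mulrA IH -scalerAr mulrA wpar_cons.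
    have gw : sgen u * sword w2
        = (-1) ^+ (p u && wpar w2) *: (sword w2 * sgen u).
      elim: w2 {ew2 IH} => [|v w2 IH].
        by rewrite sword0 mul1r mulr1 andbF scale1r.
      rewrite sword_cons mulrA (sgenC u v) -scalerAl -(mulrA _ _ (sword w2)) IH.
      rewrite -scalerAr scalerA.
      by rewrite -signr_addb wpar_cons andb_addr mulrA.
    by rewrite (mulrA (sgen u)) gw -scalerAl scalerA -signr_addb andb_addl addbC.
  + move=> IH1 IH2; rewrite mulrDr mulrDl -scalerAr -scalerAl IH1 IH2 !scalerDr !scalerA.
    by rewrite mulrC.
- move=> IH1 IH2; rewrite mulrDr mulrDl -scalerAr -scalerAl IH1 IH2 !scalerDr !scalerA.
  by rewrite mulrC.
Qed.

End SuperAlgebra.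

(* The particle fields besides the gauge sector (graviton, graviton ghosts,
   matter, densities, and so on), with their bidegrees and density weights. *)
Record other_fields (R : numFieldType) := OtherFields {
  other_sort :> choiceType;
  other_bideg : other_sort -> int * int;
  other_weight : other_sort -> R
}.

Section Fields.
Variables (R : numFieldType) (n : nat) (E : other_fields R).

Inductive particle_field : Type :=
  | gauge_boson of 'I_n & 'I_4
  | lautrup_nakanishi of 'I_n
  | ghost of 'I_n
  | antighost of 'I_n
  | other of E.

Definition field_code (phi : particle_field) : 'I_n * 'I_4 + 'I_n + ('I_n + 'I_n) + E :=
  match phi with
  | gauge_boson a mu => inl (inl (inl (a, mu)))
  | lautrup_nakanishi a => inl (inl (inr a))
  | ghost a => inl (inr (inl a))
  | antighost a => inl (inr (inr a))
  | other e => inr e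
  end.

Definition field_decode (x : 'I_n * 'I_4 + 'I_n + ('I_n + 'I_n) + E) : particle_field :=
  match x with
  | inl (inl (inl (a, mu))) => gauge_boson a mu
  | inl (inl (inr a)) => lautrup_nakanishi a
  | inl (inr (inl a)) => ghost a
  | inl (inr (inr a)) => antighost a
  | inr e => other e
  end.

Lemma field_codeK : cancel field_code field_decode. Proof. by case. Qed.

HB.instance Definition _ := Choice.copy particle_field (can_type field_codeK).

(* (graviton-ghost degree, gauge-ghost degree) *)
Definition field_bideg (phi : particle_field) : int * int :=
  match phi with
  | gauge_boson _ _ | lautrup_nakanishi _ => (0, 0)
  | ghost _ => (0, 1)
  | antighost _ => (0, -1)
  | other e => other_bideg e
  end.

Definition field_weight (phi : particle_field) : R :=
  if phi is other e then other_weight e else 0.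

Definition multi_index := {ffun 'I_4 -> nat}.
Definition midx0 : multi_index := [ffun=> 0%N].
Definition midx_succ (mu : 'I_4) (alpha : multi_index) : multi_index :=
  [ffun nu => (alpha nu + (nu == mu))%N].
Definition midx_order (alpha : multi_index) : nat := (\sum_mu alpha mu)%N.

(* The jet (phi, alpha) stands for the partial derivative of phi along the
   multi-index alpha. *)
Definition jet : choiceType := (particle_field * multi_index)%type.

Definition jet_parity (v : jet) : bool :=
  odd (absz ((field_bideg v.1).1 + (field_bideg v.1).2)).

Definition CQ : algType R := superalg R jet_parity.

Definition word_bideg (w : seq jet) : int * int :=
  \sum_(v <- w) field_bideg v.1.
Definition word_weight (w : seq jet) : R := \sum_(v <- w) field_weight v.1.

Definition has_bideg (d : int * int) : CQ -> Prop :=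
  spanned (fun w => word_bideg w = d).

(* The part of tensor density weight k and bidegree d. *)
Definition CQ_part (k : R) (d : int * int) : CQ -> Prop :=
  spanned (fun w => word_weight w = k /\ word_bideg w = d).

Definition jgen (v : jet) : CQ := sgen R jet_parity v.
Definition fgen (phi : particle_field) : CQ := jgen (phi, midx0).
Definition Agen a mu := fgen (gauge_boson a mu).
Definition bgen a := fgen (lautrup_nakanishi a).
Definition cgen a := fgen (ghost a).
Definition cbargen a := fgen (antighost a).

(* The total derivative along x^mu. *)
Definition dtot (mu : 'I_4) : CQ -> CQ :=
  sderiv false (fun v : jet => jgen (v.1, midx_succ mu v.2)).

Definition dtot_multi (alpha : multi_index) (x : CQ) : CQ :=
  foldr (fun mu y => iter (alpha mu) (dtot mu) y) x (enum 'I_4).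

(* The (left) partial derivative with respect to the jet coordinate v. *)
Definition djet (v : jet) : CQ -> CQ :=
  sderiv (jet_parity v) (fun u : jet => (u == v)%:R : CQ).

(* The Euler-Lagrange expression with respect to b_a; only finitely many
   terms are nonzero. *)
Definition euler_lagrange_b (L : CQ) (a : 'I_n) : CQ :=
  \sum_(alpha \in [set: multi_index])
    (-1) ^+ midx_order alpha *:
      dtot_multi alpha (djet (lautrup_nakanishi a, alpha) L).

(* Insertion of beta_a for b_a, together with all its derivatives. *)
Definition subst_b (beta : 'I_n -> CQ) : CQ -> CQ :=
  slift (fun v : jet =>
    if v.1 is lautrup_nakanishi a then dtot_multi v.2 (beta a) else jgen v).

Definition b_free : CQ -> Prop :=
  spanned (all (fun v : jet => if v.1 is lautrup_nakanishi _ then false else true)).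

(* Spacetime 4-forms with values in CQ, evaluated on the four vectors given by
   the rows of a matrix; dVeta is dt /\ dx /\ dy /\ dz. *)
Definition form4 := 'M[R]_4 -> CQ.
Definition dVeta (x : CQ) : form4 := fun V => \det V *: x.

(* beta expresses the auxiliary particle_field through the other fields, and inserting
   it solves the Euler-Lagrange equation of L with respect to b. *)
Definition solves_b_eom (L : form4) (beta : 'I_n -> CQ) : Prop :=
  (forall a, CQ_part 0 (0, 0) (beta a) /\ b_free (beta a)) /\
  (forall a V, subst_b beta (euler_lagrange_b (L V) a) = 0).

(* L' is L after eliminating b by its equation of motion. *)
Definition b_eliminated (L L' : form4) : Prop :=
  exists beta, [/\ solves_b_eom L beta,
    forall beta', solves_b_eom L beta' -> beta' =1 beta &
    forall V, subst_b beta (L V) = L' V].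

(* eta_{mu nu}; the upper-index metric is its inverse. *)
Definition minkowski : 'M[R]_4 :=
  diag_mx (\row_mu (if mu == 0 then 1 else -1)).
Definition minkowski_inv : 'M[R]_4 := invmx minkowski.

Definition delta (a b : 'I_n) : R := (a == b)%:R.

(* f a b c is f^a_{bc}, that is, [T_b, T_c] = sum_a f^a_{bc} T_a. *)
Record lie_structure_constants (f : 'I_n -> 'I_n -> 'I_n -> R) : Prop := {
  lie_antisym : forall a b c, f a b c = - f a c b;
  lie_jacobi : forall a b c d,
    \sum_e (f a b e * f e c d + f a c e * f e d b + f a d e * f e b c) = 0
}.

Record gauge_BRST (f : 'I_n -> 'I_n -> 'I_n -> R) (g xi : R)
    (Q : CQ -> CQ) : Prop := {
  BRST_linear : linear Q;
  BRST_bideg : forall d x, has_bideg d x -> has_bideg (d + (0, 1)) (Q x);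
  BRST_leibniz : forall d x y, has_bideg d x ->
    Q (x * y) = Q x * y + (-1) ^+ odd (absz (d.1 + d.2)) *: (x * Q y);
  BRST_dtot : forall mu x, Q (dtot mu x) = dtot mu (Q x);
  BRST_A : forall a mu, Q (Agen a mu) =
    xi^-1 *: dtot mu (cgen a)
    + g *: \sum_b \sum_c f a b c *: (cgen b * Agen c mu);
  BRST_c : forall a, Q (cgen a) =
    (g / 2) *: \sum_b \sum_c f a b c *: (cgen b * cgen c);
  BRST_cbar : forall a, Q (cbargen a) = xi^-1 *: bgen a;
  BRST_b : forall a, Q (bgen a) = 0
}.

(* lL^a *)
Definition lorenz (g : R) (a : 'I_n) : CQ :=
  g *: \sum_mu \sum_nu minkowski_inv mu nu *: dtot mu (Agen a nu).

Definition gauge_fixing_fermion (g : R) : form4 := dVeta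
  (\sum_a cbargen a *
    (g^-1 *: lorenz g a + 2^-1 *: \sum_b delta a b *: bgen b)).

Definition QYM_GF_Ghost (f : 'I_n -> 'I_n -> 'I_n -> R) (g xi : R) : form4 :=
  dVeta
  (- ((2 * g ^+ 2 * xi)^-1 *:
        \sum_a \sum_b delta a b *: (lorenz g a * lorenz g b))
   - xi^-1 *: (\sum_mu \sum_nu \sum_a minkowski_inv mu nu *:
        (cbargen a * dtot mu (dtot nu (cgen a))))
   - g *: (\sum_mu \sum_nu \sum_a \sum_b \sum_c
        (minkowski_inv mu nu * f a b c) *:
          (cbargen a * dtot mu (cgen b * Agen c nu)))).

End Fields.

Section BRSTExists.
Variables (R : numFieldType) (n : nat) (E : other_fields R).
Local Notation jet := (jet n E).
Local Notation CQ := (CQ n E).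
Local Notation par := (@jet_parity R n E).
Local Notation jword := (@sword R jet par).

Lemma odd_absD (a b : int) :
  odd (absz (a + b)) = odd (absz a) (+) odd (absz b).
Proof.
have key (x y : nat) : odd `|x%:Z - y%:Z|%N = odd x (+) odd y.
  case: (leqP x y) => xy; first by rewrite distnEr // oddB // addbC.
  by rewrite distnEl 1?ltnW // oddB // ltnW.
case: a b => [a|a] [b|b].
- by rewrite -PoszD /= oddD.
- by rewrite NegzE key abszN; reflexivity.
- by rewrite NegzE addrC key abszN addbC; reflexivity.
- by rewrite !NegzE -opprD !abszN -PoszD [absz _]/= oddD; reflexivity.
Qed.

Lemma odd_bidegD (d e : int * int) : odd (absz ((d + e).1 + (d + e).2)) =
  odd (absz (d.1 + d.2)) (+) odd (absz (e.1 + e.2)).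
Proof. by rewrite -odd_absD addrACA. Qed.

Lemma word_bideg_cons v (w : seq jet) :
  word_bideg (v :: w) = field_bideg v.1 + word_bideg w.
Proof. exact: big_cons. Qed.

Lemma wpar_bideg (w : seq jet) :
  wpar par w = odd (absz ((word_bideg w).1 + (word_bideg w).2)).
Proof.
elim: w => [|v w IH]; first by rewrite /word_bideg big_nil.
by rewrite wpar_cons IH word_bideg_cons odd_bidegD.
Qed.

Lemma bideg_par d (x : CQ) : has_bideg d x ->
  spanned (fun w => wpar par w = odd (absz (d.1 + d.2))) x.
Proof. by apply: spanned_sub => w <-; rewrite wpar_bideg. Qed.

Lemma jgen_bideg (v : jet) : has_bideg (field_bideg v.1) (jgen v).
Proof. by apply: spanned_gen; rewrite word_bideg_cons /word_bideg big_nil addr0. Qed.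

Lemma has_bidegM d1 d2 (x y : CQ) :
  has_bideg d1 x -> has_bideg d2 y -> has_bideg (d1 + d2) (x * y).
Proof.
by apply: spannedM => w1 w2 <- <-; rewrite /word_bideg big_cat.
Qed.

Lemma has_bidegZ d a (x : CQ) : has_bideg d x -> has_bideg d (a *: x).
Proof.
by move=> hx; have := spanned_lin a hx (@spanned0 R jet par _); rewrite addr0.
Qed.

Lemma has_bidegD d (x y : CQ) :
  has_bideg d x -> has_bideg d y -> has_bideg d (x + y).
Proof. by move=> hx hy; have := spanned_lin 1 hx hy; rewrite scale1r. Qed.

Lemma has_bideg_sum d (I : finType) (F : I -> CQ) :
  (forall i, has_bideg d (F i)) -> has_bideg d (\sum_i F i).
Proof.
move=> hF; elim/big_ind: _ => //; first exact: spanned0.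
by move=> x y; apply: has_bidegD.
Qed.

Section Derivation.
Variables (q : bool) (e : int * int) (phi : jet -> CQ).
Hypothesis he : odd (absz (e.1 + e.2)) = q.
Hypothesis hphi : forall v, has_bideg (field_bideg v.1 + e) (phi v).

Lemma sderiv_comm u v : phi u * jgen v =
  (-1) ^+ ((q (+) par u) && par v) *: (jgen v * phi u).
Proof.
rewrite (spanned_supercomm (bideg_par (hphi u)) (bideg_par (jgen_bideg v))).
by rewrite odd_bidegD he addbC.
Qed.

Lemma sderiv_bideg_leibniz d (x y : CQ) : has_bideg d x ->
  sderiv q phi (x * y) = sderiv q phi x * y
    + (-1) ^+ (q && odd (absz (d.1 + d.2))) *: (x * sderiv q phi y).
Proof.
have lin a z t : sderiv q phi (a *: z + t) = a *: sderiv q phi z + sderiv q phi t.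
  exact: (sderiv_linear sderiv_comm).
pose P z := sderiv q phi (z * y) = sderiv q phi z * y
    + (-1) ^+ (q && odd (absz (d.1 + d.2))) *: (z * sderiv q phi y).
apply: (spannedP (Q := P)); rewrite /P.
- have := lin (-1) 0 0; rewrite scaler0 addr0 scaleN1r addNr => D0.
  by rewrite !mul0r D0 mul0r scaler0 addr0.
- by move=> w <-; rewrite (sderiv_leibniz sderiv_comm) wpar_bideg.
- move=> a z t hz ht; rewrite mulrDl -scalerAl !lin hz ht !mulrDl !scalerDr.
  by rewrite addrACA -!scalerAl !scalerA (mulrC a).
Qed.

Lemma sderiv_bideg d (x : CQ) :
  has_bideg d x -> has_bideg (d + e) (sderiv q phi x).
Proof.
have lin a z t : sderiv q phi (a *: z + t) = a *: sderiv q phi z + sderiv q phi t.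
  exact: (sderiv_linear sderiv_comm).
apply: (spannedP (Q := fun x => has_bideg (d + e) (sderiv q phi x)))
  => [|w <-|a z t hz ht].
- have := lin (-1) 0 0; rewrite scaler0 addr0 scaleN1r addNr => ->.
  exact: spanned0.
- rewrite (sderiv_sword sderiv_comm); elim: w => [|v w IH].
    exact: spanned0.
  rewrite /= word_bideg_cons; apply: has_bidegD.
    by rewrite addrAC; apply: has_bidegM => //; apply: spanned_word.
  by apply: has_bidegZ; rewrite -addrA; apply: has_bidegM => //; apply: jgen_bideg.
- by rewrite lin; apply: spanned_lin.
Qed.

End Derivation.

Let shift mu (v : jet) : CQ := jgen (v.1, midx_succ mu v.2).

Let bideg0_even : odd (absz ((0 : int * int).1 + (0 : int * int).2)) = false.
Proof. by []. Qed.

Lemma shift_bideg mu v : has_bideg (field_bideg v.1 + 0) (shift mu v).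
Proof. by rewrite addr0; apply: jgen_bideg. Qed.

Lemma dtot_linear mu : linear (@dtot R n E mu).
Proof.
exact: (sderiv_linear (sderiv_comm bideg0_even (shift_bideg mu))).
Qed.

Lemma dtotM mu (x y : CQ) : dtot mu (x * y) = dtot mu x * y + x * dtot mu y.
Proof.
elim/superalg_ind: x => [w|a z t hz ht].
  rewrite /dtot (sderiv_leibniz (sderiv_comm bideg0_even
    (shift_bideg mu))).
  by rewrite scale1r.
by rewrite mulrDl -scalerAl !dtot_linear hz ht !mulrDl scalerDr addrACA -!scalerAl.
Qed.

Lemma dtot_jgen mu (v : jet) : dtot mu (jgen v) = jgen (v.1, midx_succ mu v.2).
Proof.
exact: (sderiv_sgen (sderiv_comm bideg0_even (shift_bideg mu))).
Qed.

Lemma dtot1 mu : dtot mu (1 : CQ) = 0.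
Proof.
have := dtotM mu 1 1; rewrite !mulr1 mul1r => /(congr1 (fun x => x - dtot mu 1)).
by rewrite subrr addrK => <-.
Qed.

Lemma dtot_bideg mu d (x : CQ) : has_bideg d x -> has_bideg d (dtot mu x).
Proof.
move=> hx; rewrite -[d]addr0.
exact: (sderiv_bideg bideg0_even (shift_bideg mu)).
Qed.

Lemma sderiv_dtot q e (phi : jet -> CQ) mu :
    odd (absz (e.1 + e.2)) = q ->
    (forall v, has_bideg (field_bideg v.1 + e) (phi v)) ->
    (forall v, phi (v.1, midx_succ mu v.2) = dtot mu (phi v)) ->
  forall x, sderiv q phi (dtot mu x) = dtot mu (sderiv q phi x).
Proof.
move=> he hphi hmu x.
have hC := sderiv_comm he hphi.
have lin a z t : sderiv q phi (a *: z + t) = a *: sderiv q phi z + sderiv q phi t.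
  exact: (sderiv_linear hC).
have g v : sderiv q phi (jgen v) = phi v by exact: (sderiv_sgen hC).
have L v y : sderiv q phi (jgen v * y) =
    phi v * y + (-1) ^+ (q && par v) *: (jgen v * sderiv q phi y).
  by rewrite (sderiv_bideg_leibniz he hphi _ (jgen_bideg v)) g.
have D0 : sderiv q phi 0 = 0.
  by have := lin (-1) 0 0; rewrite scaler0 addr0 scaleN1r addNr.
have d0 : dtot mu (0 : CQ) = 0.
  by have := dtot_linear mu (-1) 0 0; rewrite scaler0 addr0 scaleN1r addNr.
elim/superalg_ind: x => [w|a z t hz ht]; last by rewrite !(lin, dtot_linear) hz ht.
elim: w => [|v w IH].
  rewrite sword0 dtot1 D0 -sword0 (sderiv_sword hC) /=.
  by rewrite d0.
rewrite sword_cons -/(jgen v) dtotM dtot_jgen -[X in sderiv q phi X]scale1r.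
rewrite scalerDr lin !scale1r !L IH hmu.
rewrite [X in _ = dtot mu X]addrC dtot_linear !dtotM dtot_jgen.
rewrite scalerDr [RHS]addrC -!addrA; congr (_ + _); rewrite addrCA.
by [].
Qed.

Lemma dtotC mu nu (x : CQ) : dtot mu (dtot nu x) = dtot nu (dtot mu x).
Proof.
apply: (sderiv_dtot bideg0_even (shift_bideg mu)) => v.
rewrite dtot_jgen; congr (jgen (_, _)); apply/ffunP => k.
by rewrite !ffunE addnAC.
Qed.

Lemma dtot_multi0 (x : CQ) : dtot_multi midx0 x = x.
Proof.
rewrite /dtot_multi; elim: (enum _) => [|mu s IH] //=.
by rewrite IH ffunE.
Qed.

Lemma dtot_multi_succ mu alpha (x : CQ) :
  dtot_multi (midx_succ mu alpha) x = dtot mu (dtot_multi alpha x).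
Proof.
have iterC k nu (y : CQ) : iter k (@dtot R n E nu) (dtot mu y)
    = dtot mu (iter k (@dtot R n E nu) y).
  by elim: k => //= k ->; rewrite dtotC.
rewrite /dtot_multi.
have := mem_enum 'I_4 mu; have := enum_uniq 'I_4; rewrite inE.
elim: (enum _) => [|nu s IH] //= /andP[nus us]; rewrite inE ffunE.
case: (eqVneq mu nu) nus => [<- mus _ | nmu nus /= mus].
  rewrite addn1 iterS; congr (dtot mu (iter _ _ _)).
  elim: s mus {us IH} => //= k s IH; rewrite inE negb_or => /andP[kmu /IH ->].
  by rewrite ffunE eq_sym (negPf kmu) addn0.
by rewrite addn0 IH // iterC.
Qed.

Lemma dtot_multi_bideg alpha d (x : CQ) :
  has_bideg d x -> has_bideg d (dtot_multi alpha x).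
Proof.
move=> hx; rewrite /dtot_multi; elim: (enum _) => [|mu s IH] //=.
by elim: (alpha mu) => //= k; apply: dtot_bideg.
Qed.

(* Whatever the structure constants and the couplings, an operator as in
   gauge_BRST exists. *)
Lemma gauge_BRST_exists (f : 'I_n -> 'I_n -> 'I_n -> R) (g xi : R) :
  exists Q : CQ -> CQ, gauge_BRST f g xi Q.
Proof.
pose Qf (phi : particle_field n E) : CQ := match phi with
  | gauge_boson a mu => xi^-1 *: dtot mu (cgen E a)
      + g *: \sum_b \sum_c f a b c *: (cgen E b * Agen E c mu)
  | ghost a => (g / 2) *: \sum_b \sum_c f a b c *: (cgen E b * cgen E c)
  | antighost a => xi^-1 *: bgen E a
  | _ => 0
  end.
have Qf_bideg phi : has_bideg (field_bideg phi + (0, 1)) (Qf phi).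
  have hgen ph : has_bideg (field_bideg ph) (fgen ph : CQ).
    exact: (jgen_bideg (ph, midx0)).
  case: phi => [a mu|a|a|a|e] /=; try exact: spanned0.
  - apply: has_bidegD; apply: has_bidegZ.
      by apply: dtot_bideg; apply: (hgen (ghost E a)).
    apply: has_bideg_sum => b; apply: has_bideg_sum => c; apply: has_bidegZ.
    exact: (has_bidegM (hgen (ghost E b)) (hgen (gauge_boson E c mu))).
  - apply/has_bidegZ/has_bideg_sum => b; apply: has_bideg_sum => c.
    apply: has_bidegZ.
    exact: (has_bidegM (hgen (ghost E b)) (hgen (ghost E c))).
  - apply: has_bidegZ; exact: (hgen (lautrup_nakanishi E a)).
pose Qphi (v : jet) := dtot_multi v.2 (Qf v.1).
have he : odd (absz (((0, 1) : int * int).1 + ((0, 1) : int * int).2)) = true by [].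
have hphi v : has_bideg (field_bideg v.1 + (0, 1)) (Qphi v).
  exact/dtot_multi_bideg/Qf_bideg.
have hC := sderiv_comm he hphi.
have Qgen phi : sderiv true Qphi (fgen phi) = Qf phi.
  by rewrite (sderiv_sgen hC) /Qphi dtot_multi0.
exists (sderiv true Qphi); split.
- exact: (sderiv_linear hC).
- by move=> d x; apply: (sderiv_bideg _ hphi).
- by move=> d x y; apply: (sderiv_bideg_leibniz _ hphi).
- move=> mu x; apply: (sderiv_dtot _ hphi) => // v.
  by rewrite /Qphi /= dtot_multi_succ.
- by move=> a mu; apply: (Qgen (gauge_boson E a mu)).
- by move=> a; apply: (Qgen (ghost E a)).
- by move=> a; apply: (Qgen (antighost E a)).
- by move=> a; apply: (Qgen (lautrup_nakanishi E a)).
Qed.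

End BRSTExists.

(* Main.v *)
(** Applying [Q] to the fermion gives, with [D^a := g^-1 lL^a],
    [xi^-1 b_a (D^a + b^a / 2) - cbar_a Q D^a], where the sign comes from the
    odd parity of [cbar_a]. Only the first summand involves [b], and no
    derivative of [b] occurs, so the equation of motion is
    [xi^-1 (D^a + b^a) = 0]. Its solution [b^a = - D^a] turns the first summand
    into [- (2 xi)^-1 D_a D^a], the gauge fixing term, while [- cbar_a Q D^a] is
    the ghost term. *)
Require Import Defs.
From HB Require Import structures.
From mathcomp Require Import all_boot all_order all_algebra reals.
From mathcomp Require Import classical_sets fsbigop ring.
Set Implicit Arguments.
Unset Strict Implicit.
Import GRing.Theory.
Local Open Scope ring_scope.

(** * Linear closure of spans of words *)

Section Spanned.
Variables (R : numFieldType) (J : choiceType) (p : J -> bool).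
Variable P : seq J -> Prop.
Implicit Types x y : superalg R p.

Lemma spannedZ a x : spanned P x -> spanned P (a *: x).
Proof. by move=> hx; rewrite -[_ *: _]addr0; apply: spanned_lin (spanned0 _ _ _). Qed.

Lemma spannedD x y : spanned P x -> spanned P y -> spanned P (x + y).
Proof. by move=> hx; rewrite -[x]scale1r; apply: spanned_lin. Qed.

Lemma spannedN x : spanned P x -> spanned P (- x).
Proof. by rewrite -scaleN1r; apply: spannedZ. Qed.

Lemma spanned_sum (I : finType) (F : I -> superalg R p) :
  (forall i, spanned P (F i)) -> spanned P (\sum_i F i).
Proof.
move=> hF; elim/big_ind: _ => //; first exact: spanned0.
by move=> x y; apply: spannedD.
Qed.

End Spanned.

Section GaugeFixing.
Variables (R : numFieldType) (n : nat) (E : other_fields R).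
Local Notation jet := (jet n E).
Local Notation CQ := (CQ n E).
Local Notation par := (@jet_parity R n E).

HB.instance Definition _ mu := GRing.isLinear.Build R CQ CQ *:%R
  (@dtot R n E mu) (@dtot_linear R n E mu).

(** * Degree, weight and absence of [b] in the Lorenz functional *)

Lemma CQ_partM k1 k2 d1 d2 (x y : CQ) :
  CQ_part k1 d1 x -> CQ_part k2 d2 y -> CQ_part (k1 + k2) (d1 + d2) (x * y).
Proof.
apply: spannedM => w1 w2 [<- <-] [<- <-].
by rewrite /word_weight /word_bideg !big_cat.
Qed.

Lemma CQ_part_jgen (v : jet) :
  CQ_part (field_weight v.1) (field_bideg v.1) (jgen v).
Proof. by apply: spanned_gen; rewrite /word_weight /word_bideg !big_seq1. Qed.

Lemma CQ_part_bideg k d (x : CQ) : CQ_part k d x -> has_bideg d x.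
Proof. by apply: spanned_sub => w []. Qed.

Lemma b_freeM (x y : CQ) : b_free x -> b_free y -> b_free (x * y).
Proof. by apply: spannedM => w1 w2 h1 h2; rewrite all_cat h1. Qed.

Lemma b_free_jgen (v : jet) :
  (if v.1 is lautrup_nakanishi _ then false else true) ->
  b_free (jgen v).
Proof. by move=> hv; apply: spanned_gen; rewrite /= hv. Qed.

(** A total derivative only shifts the multi-index of a generator. The resulting combination of
    one-letter words displays weight, degree and absence of [b]. *)
Lemma lorenzE g (a : 'I_n) : lorenz E g a =
  g *: \sum_mu \sum_nu minkowski_inv R mu nu
    *: jgen ((gauge_boson E a nu, midx_succ mu midx0) : jet).
Proof.
rewrite /lorenz; congr (_ *: _); apply: eq_bigr => mu _; apply: eq_bigr => nu _.
by rewrite dtot_jgen.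
Qed.

Lemma lorenz_part g (a : 'I_n) : CQ_part 0 (0, 0) (lorenz E g a).
Proof.
rewrite lorenzE; apply/spannedZ/spanned_sum => mu; apply/spanned_sum => nu.
exact/spannedZ/CQ_part_jgen.
Qed.

Lemma lorenz_b_free g (a : 'I_n) : b_free (lorenz E g a).
Proof.
rewrite lorenzE; apply/spannedZ/spanned_sum => mu; apply/spanned_sum => nu.
exact/spannedZ/b_free_jgen.
Qed.

Lemma sum_delta (a : 'I_n) (F : 'I_n -> CQ) :
  \sum_b delta R a b *: F b = F a.
Proof.
rewrite (bigD1 a) //= /delta eqxx scale1r big1 ?addr0 // => b.
by rewrite eq_sym => /negPf ->; rewrite scale0r.
Qed.

(** * Partial derivatives along the jets of [b] *)

Section PartialDerivative.
Variables (a : 'I_n) (alpha : multi_index).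
Let v : jet := (lautrup_nakanishi E a, alpha).

(** This compatibility makes [djet v] well defined on the quotient: for [u] distinct from [v] both
    sides vanish, and for [u = v] the two parities cancel in the sign. *)
Let djet_comm (u w : jet) : (u == v)%:R * jgen w =
  (-1) ^+ ((par v (+) par u) && par w) *: (jgen w * (u == v)%:R) :> CQ.
Proof.
case: (u =P v) => [->|_]; last by rewrite mul0r mulr0 scaler0.
by rewrite addbb scale1r mul1r mulr1.
Qed.

Lemma djet_b_linear : linear (djet v : CQ -> CQ).
Proof. exact: (sderiv_linear djet_comm). Qed.

HB.instance Definition _ := GRing.isLinear.Build R CQ CQ *:%R
  (djet v) djet_b_linear.

(** The field [b] is even, so the Leibniz rule carries no sign. *)
Lemma djet_bM (x y : CQ) : djet v (x * y) = djet v x * y + x * djet v y.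
Proof.
elim/superalg_ind: x => [w|c z t hz ht].
  by rewrite /djet (sderiv_leibniz djet_comm) scale1r.
by rewrite mulrDl -scalerAl !linearP /= hz ht !mulrDl scalerDr addrACA -!scalerAl.
Qed.

Lemma djet_b_jgen (u : jet) : djet v (jgen u) = (u == v)%:R.
Proof. exact: (sderiv_sgen djet_comm). Qed.

Lemma djet_b_free (x : CQ) : b_free x -> djet v x = 0.
Proof.
apply: (spannedP (Q := fun x => djet v x = 0)) => [|w|c y z hy hz].
- exact: linear0.
- rewrite /djet (sderiv_sword djet_comm).
  elim: w => //= u w IH /andP[hu /IH ->].
  rewrite mulr0 scaler0 addr0; case: eqP hu => [-> //|_ _].
  by rewrite mul0r.
- by rewrite linearP /= hy hz scaler0 addr0.
Qed.

End PartialDerivative.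

(** * Insertion of values for [b] *)

Section Substitution.
Variable beta : 'I_n -> CQ.
Hypothesis beta_bideg : forall a, has_bideg (0, 0) (beta a).

Let sub (v : jet) : CQ :=
  if v.1 is lautrup_nakanishi a then dtot_multi v.2 (beta a) else jgen v.

Let sub_bideg v : has_bideg (field_bideg v.1) (sub v).
Proof.
rewrite /sub; case: v => -[a mu|a|a|a|e] al /=;
  try exact: (jgen_bideg (_, al)).
exact/dtot_multi_bideg/beta_bideg.
Qed.

(** Total derivatives preserve degree, so each inserted value has the degree of the generator it
    replaces and supercommutes like it. Hence insertion is an algebra morphism. *)
Let subC u v : sub u * sub v = (-1) ^+ (par u && par v) *: (sub v * sub u).
Proof.
exact: (spanned_supercomm (bideg_par (sub_bideg u)) (bideg_par (sub_bideg v))).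
Qed.

HB.instance Definition _ := GRing.isLinear.Build R CQ CQ *:%R
  (subst_b beta) (slift_linear subC).

Lemma subst_bZ c (x : CQ) : subst_b beta (c *: x) = c *: subst_b beta x.
Proof. exact: linearZ. Qed.

Lemma subst_bD (x y : CQ) :
  subst_b beta (x + y) = subst_b beta x + subst_b beta y.
Proof. exact: linearD. Qed.

Lemma subst_b_sum (I : finType) (F : I -> CQ) :
  subst_b beta (\sum_i F i) = \sum_i subst_b beta (F i).
Proof. exact: linear_sum. Qed.

Lemma subst_bM (x y : CQ) :
  subst_b beta (x * y) = subst_b beta x * subst_b beta y.
Proof. exact: (slift_monoid subC).2. Qed.

Lemma subst_b_bgen a : subst_b beta (bgen E a) = beta a.
Proof. by rewrite /subst_b (slift_sgen subC) /sub /= dtot_multi0. Qed.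

Lemma subst_b_free (x : CQ) : b_free x -> subst_b beta x = x.
Proof.
apply: (spannedP (Q := fun x => subst_b beta x = x)) => [|w|c y z hy hz].
- exact: linear0.
- rewrite /subst_b (slift_sword subC); elim: w => [|u w IH] /=.
    by rewrite big_nil sword0.
  move=> /andP[hu /IH]; rewrite big_cons sword_cons => ->; congr (_ * _).
  by case: u hu => -[].
- by rewrite linearP /= hy hz.
Qed.

End Substitution.

(** If no derivative of [b_a] contributes, the sum collapses to the multi-index zero, where the sign
    is 1 and no total derivative acts. *)
Lemma euler_lagrange_b_order0 (L : CQ) (a : 'I_n) :
    (forall alpha, alpha != midx0 -> djet (lautrup_nakanishi E a, alpha) L = 0) ->
  euler_lagrange_b L a = djet (lautrup_nakanishi E a, midx0) L.
Proof.
move=> hL; rewrite /euler_lagrange_b -(@fsbig_widen _ _ _ _ [set midx0]%classic).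
- rewrite fsbig_set1 dtot_multi0 /midx_order big1 ?scale1r // => mu _.
  by rewrite ffunE.
- by [].
- move=> alpha [_ /= /eqP halpha]; rewrite hL //.
  suff -> : dtot_multi alpha (0 : CQ) = 0 by rewrite scaler0.
  rewrite /dtot_multi; elim: (enum _) => [|mu s IH] //=; rewrite IH.
  by elim: (alpha mu) => //= k ->; rewrite linear0.
Qed.

(** * The BRST variation of the fermion and the elimination of [b] *)

Section BRST.
Variables (f : 'I_n -> 'I_n -> 'I_n -> R) (g xi : R) (Q : CQ -> CQ).
Hypotheses (g0 : g != 0) (xi0 : xi != 0) (hQ : gauge_BRST f g xi Q).

HB.instance Definition _ := GRing.isLinear.Build R CQ CQ *:%R Q (BRST_linear hQ).

Local Notation D a := (g^-1 *: lorenz E g a).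

(** [g^-1] cancels the coupling inside [lorenz], and [Q] passes through the total derivative to act
    on the gauge boson. *)
Lemma BRST_lorenz (a : 'I_n) : Q (D a) =
  \sum_mu \sum_nu minkowski_inv R mu nu *:
    (xi^-1 *: dtot mu (dtot nu (cgen E a))
     + g *: \sum_b \sum_c f a b c *: dtot mu (cgen E b * Agen E c nu)).
Proof.
rewrite /lorenz scalerA mulVf // scale1r linear_sum; apply: eq_bigr => mu _.
rewrite linear_sum; apply: eq_bigr => nu _.
rewrite linearZ /= (BRST_dtot hQ) (BRST_A hQ) linearD !linearZ /=.
congr (_ *: (_ + _ *: _)); rewrite linear_sum; apply: eq_bigr => b _.
by rewrite linear_sum; apply: eq_bigr => c _; rewrite linearZ.
Qed.

Lemma BRST_lorenz_b_free (a : 'I_n) : b_free (Q (D a)).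
Proof.
rewrite BRST_lorenz; apply: spanned_sum => mu; apply: spanned_sum => nu.
apply/spannedZ/spannedD; apply: spannedZ.
  by rewrite !dtot_jgen; apply: b_free_jgen.
apply: spanned_sum => b; apply: spanned_sum => c; apply: spannedZ.
by rewrite dtotM !dtot_jgen; apply: spannedD; apply: b_freeM; apply: b_free_jgen.
Qed.

(** The Leibniz rule gives the minus sign since the antighost has degree [(0, -1)]; [Q b = 0]
    removes the variation of the quadratic term. *)
Lemma BRST_fermion V : Q (gauge_fixing_fermion n E g V) =
  \det V *: (xi^-1 *: (\sum_a bgen E a * (D a + 2^-1 *: bgen E a))
             - \sum_a cbargen E a * Q (D a)).
Proof.
rewrite /gauge_fixing_fermion /dVeta linearZ /=; congr (_ *: _).
rewrite linear_sum scaler_sumr -sumrB; apply: eq_bigr => a _.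
have cbar_bideg : has_bideg (0, -1) (cbargen E a).
  exact: (jgen_bideg (antighost E a, midx0)).
rewrite sum_delta /= (BRST_leibniz hQ _ cbar_bideg).
rewrite (BRST_cbar hQ) linearD (linearZ_LR _ 2^-1) /= (BRST_b hQ) scaler0 addr0.
by rewrite scaleN1r scalerAl.
Qed.

Lemma euler_lagrange_b_BRST_fermion V (a : 'I_n) :
  euler_lagrange_b (Q (gauge_fixing_fermion n E g V)) a =
  (\det V * xi^-1) *: (D a + bgen E a).
Proof.
have dE alpha : djet (lautrup_nakanishi E a, alpha)
      (Q (gauge_fixing_fermion n E g V)) =
    (\det V * xi^-1) *: ((alpha == midx0)%:R * (D a + bgen E a)).
  set v : jet := (_, _).
  have db b : djet v (bgen E b) = ((b == a) && (alpha == midx0))%:R.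
    by rewrite djet_b_jgen xpair_eqE (eq_sym alpha).
  have dfree : djet v (\sum_b cbargen E b * Q (D b)) = 0.
    apply/djet_b_free/spanned_sum => b.
    exact/b_freeM/BRST_lorenz_b_free/b_free_jgen.
  have dsum (F : 'I_n -> CQ) : djet v (\sum_b F b) = \sum_b djet v (F b).
    exact: linear_sum.
  (* Each of the two factors contributes half of [b], which together restore coefficient 1. *)
  have dterm b : djet v (bgen E b * (D b + 2^-1 *: bgen E b)) =
      ((b == a) && (alpha == midx0))%:R * (D b + bgen E b).
    have lor0 : djet v (lorenz E g b) = 0 by exact/djet_b_free/lorenz_b_free.
    rewrite djet_bM linearD (linearZ_LR _ g^-1) (linearZ_LR _ 2^-1) /= -/v lor0 !db scaler0 add0r.
    case: (_ && _); last by rewrite !(mul0r, scaler0, mulr0) addr0.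
    rewrite !mul1r -scalerAr mulr1 -addrA -scalerDl; congr (_ + _).
    by rewrite -[RHS]scale1r; congr (_ *: _); field.
  rewrite BRST_fermion linearZ linearB /= (linearZ_LR _ xi^-1) /=.
  rewrite dfree subr0 dsum scalerA; congr (_ *: _).
  rewrite (bigD1 a) //= big1 ?addr0 => [|b /negPf ba]; first by rewrite dterm eqxx.
  by rewrite dterm ba mul0r.
rewrite euler_lagrange_b_order0 => [|alpha /negPf halpha].
  by rewrite dE eqxx mul1r.
by rewrite dE halpha mul0r scaler0.
Qed.

(** The degree condition makes insertion a morphism and [D a] is free of [b], so the equation of
    motion becomes linear in [beta a]. *)
Lemma solves_b_eom_BRST_fermion (beta : 'I_n -> CQ) :
    (forall a, CQ_part 0 (0, 0) (beta a) /\ b_free (beta a)) ->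
  solves_b_eom (fun V => Q (gauge_fixing_fermion n E g V)) beta <->
  (forall a, beta a = - D a).
Proof.
move=> hbeta; have bidegb a := CQ_part_bideg (hbeta a).1.
have eom a V : subst_b beta
    (euler_lagrange_b (Q (gauge_fixing_fermion n E g V)) a) =
    (\det V * xi^-1) *: (D a + beta a).
  have b_freeD : b_free (D a) by exact/spannedZ/lorenz_b_free.
  rewrite euler_lagrange_b_BRST_fermion (subst_bZ bidegb) (subst_bD bidegb).
  by rewrite (subst_b_free bidegb b_freeD) (subst_b_bgen bidegb).
split=> [[_ sol] a|sol]; last first.
  by split=> // a V; rewrite eom sol subrr scaler0.
(* On the rows of the identity matrix the volume form is 1, leaving only the nonzero factor [xi^-1]
   to cancel. *)
have := sol a 1%:M; rewrite eom det1 mul1r => /eqP.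
by rewrite scaler_eq0 invr_eq0 (negPf xi0) /= addrC addr_eq0 => /eqP.
Qed.

Lemma sub_BRST_fermion V :
  subst_b (fun a => - D a) (Q (gauge_fixing_fermion n E g V)) =
  QYM_GF_Ghost E f g xi V.
Proof.
have bidegD (a : 'I_n) : has_bideg (0, 0) (- D a).
  exact: CQ_part_bideg (spannedN (spannedZ _ (lorenz_part g a))).
have ghost_free : b_free (- \sum_a cbargen E a * Q (D a)).
  apply/spannedN/spanned_sum => a.
  exact/b_freeM/BRST_lorenz_b_free/b_free_jgen.
have subD (a : 'I_n) : subst_b (fun b => - D b) (D a) = D a.
  by apply: (subst_b_free bidegD); apply/spannedZ/lorenz_b_free.
rewrite BRST_fermion (subst_bZ bidegD) (subst_bD bidegD) (subst_bZ bidegD).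
rewrite (subst_b_free bidegD ghost_free) (subst_b_sum bidegD).
(* The two ghost sums are joined into one, to be matched with the [b]-free summand that insertion
   leaves unchanged. *)
rewrite /QYM_GF_Ghost /dVeta -addrA -opprD; congr (_ *: (_ - _)).
  rewrite scaler_sumr scaler_sumr -sumrN; apply: eq_bigr => a _.
  rewrite (subst_bM bidegD) (subst_bD bidegD) subD (subst_bZ bidegD).
  rewrite (subst_b_bgen bidegD) sum_delta; move: (lorenz E g a) => L.
  rewrite scalerN -[X in X - _]scale1r -scalerBl mulNr scalerN scalerA -scalerAl -scalerAr !scalerA.
  (* The constants agree: [xi^-1 * g^-1 * (1 - 2^-1) * g^-1] equals [(2 * g ^+ 2 * xi)^-1]. *)
  by congr (- (_ *: _)); field; rewrite g0 xi0.
(* The sum over [a] is moved inside those over [mu] and [nu], the order used in [QYM_GF_Ghost], so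
   that the ghost terms can be compared one by one. *)
under [LHS]eq_bigr do rewrite BRST_lorenz mulr_sumr; rewrite exchange_big /=.
rewrite 2!scaler_sumr -big_split; apply: eq_bigr => mu _ /=.
under [LHS]eq_bigr do rewrite mulr_sumr; rewrite exchange_big /=.
rewrite 2!scaler_sumr -big_split; apply: eq_bigr => nu _ /=.
rewrite 2!scaler_sumr -big_split; apply: eq_bigr => a _ /=.
rewrite -scalerAr mulrDr scalerDr; congr (_ + _).
  by rewrite -scalerAr !scalerA mulrC.
rewrite -scalerAr mulr_sumr !scaler_sumr; apply: eq_bigr => b _.
rewrite mulr_sumr !scaler_sumr; apply: eq_bigr => c _.
by rewrite -scalerAr !scalerA mulrCA mulrA.
Qed.

End BRST.

End GaugeFixing.

Theorem proposition4p5 (R : realType) (n : nat) (E : other_fields R)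
    (f : 'I_n -> 'I_n -> 'I_n -> R) (g xi : R) (Q : CQ n E -> CQ n E)
    (hf : lie_structure_constants f) (hg : g != 0) (hxi : xi != 0)
    (hQ : gauge_BRST f g xi Q) :
  (forall V, CQ_part 0 (0, -1) (gauge_fixing_fermion n E g V)) /\
  b_eliminated (fun V => Q (gauge_fixing_fermion n E g V))
               (QYM_GF_Ghost E f g xi).
Proof.
split=> [V|].
  apply/spannedZ/spanned_sum => a; rewrite sum_delta.
  have hb : CQ_part 0 (0, 0) (g^-1 *: lorenz E g a + 2^-1 *: bgen E a).
    apply: spannedD; apply: spannedZ; first exact: lorenz_part.
    exact: (CQ_part_jgen (lautrup_nakanishi E a, midx0)).
  have := CQ_partM (CQ_part_jgen (antighost E a, midx0)) hb.
  by rewrite /= !addr0.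
have hD (a : 'I_n) : CQ_part 0 (0, 0) (- (g^-1 *: lorenz E g a)) /\
    b_free (- (g^-1 *: lorenz E g a)).
  by split; apply/spannedN/spannedZ; [apply: lorenz_part | apply: lorenz_b_free].
exists (fun a => - (g^-1 *: lorenz E g a)); split.
- exact/(solves_b_eom_BRST_fermion hg hxi hQ hD).
(* Uniqueness: any solution carries its own degree and [b]-freeness conditions, so the same
   equivalence determines it. *)
- move=> beta' sol.
  exact/(solves_b_eom_BRST_fermion hg hxi hQ sol.1).
- exact: sub_BRST_fermion.
Qed.
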